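(* Let $\nu\in\mathbb R$, let $\lambda$ be a constant and $\lambda^{*}=\lambda-\kappa_{-1}$. On the non-uniform lattices $x=x(z)$ described in the context, the adjoint difference equation $$\sigma(z+1)\frac{\Delta}{\Delta x_{-1}(z)}\Big(\frac{\nabla y(z)}{\nabla x(z)}\Big)-\tau_{-2}(z+1)\frac{\nabla y(z)}{\nabla x(z)}+\lambda^{*}y(z)=0$$ has particular solutions in the form of $$y(z)=\sum_{s=a}^{b-1}\frac{\rho_\nu(s)\nabla x_{\nu+1}(s)}{[x_\nu(s)-x_\nu(z)]^{(\nu+1)}}$$ and also in the form of $$y(z)=\oint_C\frac{\rho_\nu(s)\nabla x_{\nu+1}(s)\,ds}{[x_\nu(s)-x_\nu(z)]^{(\nu+1)}},$$ where $a,b$ are complex numbers with the same imaginary part and $b-a\in\mathbb N$, and $C$ is a contour in the complex $s$-plane, if: (i) functions $\rho(z)$ and $\rho_\nu(z)$ satisfy $\frac{\Delta}{\nabla x_1(z)}[\sigma(z)\rho(z)]=\tau(z)\rho(z)$ and $\frac{\Delta}{\nabla x_{\nu+1}(z)}[\sigma(z)\rho_\nu(z)]=\tau_\nu(z)\rho_\nu(z)$; (ii) $\nu$ satisfies $\lambda^{*}+\kappa_{\nu-1}\gamma(\nu+1)=0$; (iii) with the functions $$\phi_{\nu m}(z)=\sum_{s=a}^{b-1}\frac{\rho_\nu(s)\nabla x_{\nu+1}(s)}{[x_\nu(s)-x_\nu(z)]^{(m+1)}}\quad\text{or}\quad \phi_{\nu m}(z)=\oint_C\frac{\rho_\nu(s)\nabla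 x_{\nu+1}(s)\,ds}{[x_\nu(s)-x_\nu(z)]^{(m+1)}},$$ the difference derivative of $\phi_{\nu\nu}$ (that is, $m=\nu$) can be carried out by means of the formula $\frac{\nabla\phi_{\nu\nu}(z)}{\nabla x(z)}=\gamma(\nu+1)\phi_{\nu,\nu+1}(z)$; (iv) the following equalities hold: $$\psi_{\nu\nu}(a,z)=\psi_{\nu\nu}(b,z),\qquad \oint_C\Delta_s\psi_{\nu\nu}(s,z)\,ds=0,$$ where $$\psi_{\nu\nu}(s,z)=\frac{\sigma(s)\rho_\nu(s)}{[x_{\nu-1}(s)-x_{\nu-1}(z+1)]^{(\nu+1)}}.$$
   Context: Lattice and differences. $x(s)$, $s\in\mathbb C$, is a non-uniform lattice: either $x(s)=c_1q^s+c_2q^{-s}+c_3$ with $c_1c_2\ne0$ ($q\ne0,1$ fixed, with a fixed branch of $q^s$), or $x(s)=\tilde c_1s^2+\tilde c_2s+\tilde c_3$ with $\tilde c_1\tilde c_2\neq0$. For real $\eta$, $x_\eta(s)=x(s+\frac{\eta}{2})$. $\Delta f(s)=f(s+1)-f(s)$, $\nabla f(s)=f(s)-f(s-1)$; $\Delta_s$ means the difference is taken in $s$. Expressions are considered where denominators do not vanish. Sums $\sum_{s=a}^{b-1}$ run over $s=a,a+1,\dots,b-1$. Coefficients. $\tilde\sigma[x]$ and $\tilde\tau[x]$ are polynomials in $x$ of degrees at most two and one; $\tau(z)=\tilde\tau[x(z)]$ and $\sigma(z)=\tilde\sigma[x(z)]-\frac12\tilde\tau[x(z)]\nabla x_1(z)$.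 For real $\eta$, $\tau_\eta$ is defined by $\tau_\eta(z)\nabla x_{\eta+1}(z)=\sigma(z+\eta)-\sigma(z)+\tau(z+\eta)\nabla x_1(z+\eta)$. Put $\gamma(\eta)=\frac{q^{\eta/2}-q^{-\eta/2}}{q^{1/2}-q^{-1/2}}$ for the first kind of lattice and $\gamma(\eta)=\eta$ for the second, and $\kappa_\eta=\tilde\tau'+\frac12(\eta-1)\tilde\sigma''$ (derivatives with respect to $x$). The displayed equation is the adjoint of $\sigma(z)\frac{\Delta}{\Delta x_{-1}(z)}\big(\frac{\nabla y(z)}{\nabla x(z)}\big)+\tau(z)\frac{\Delta y(z)}{\Delta x(z)}+\lambda y(z)=0$. Generalized powers. $[x_\eta(s)-x_\eta(z)]^{(m)}$ ($\eta,m$ real) denotes Suslov's generalized power: a fixed family of functions of $(s,z)$ with $[x_\eta(s)-x_\eta(z)]^{(0)}=1$ and, for all real $\eta,m$, $$[x_\eta(s)-x_\eta(z)]\,[x_\eta(s)-x_\eta(z-1)]^{(m)}=[x_\eta(s)-x_\eta(z)]^{(m)}\,[x_\eta(s)-x_\eta(z-m)]=[x_\eta(s)-x_\eta(z)]^{(m+1)},$$ $$[x_{\eta-1}(s+1)-x_{\eta-1}(z)]^{(m)}[x_{\eta-m}(s)-x_{\eta-m}(z)]=[x_{\eta-m}(s+m)-x_{\eta-m}(z)][x_{\eta-1}(s)-x_{\eta-1}(z)]^{(m)}=[x_\eta(s)-x_\eta(z)]^{(m+1)}.$$ For a nonnegative integer $m$ it equals $\prod_{j=0}^{m-1}[x_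\eta(s)-x_\eta(z-j)]$.
   Formalization: On q-lattices κ_η is corrected to ½(q^{(η-1)/2}+q^{-(η-1)/2})τ̃'+½γ(η-1)σ̃'', as the theorem is false with the printed κ_η; the generalized-power identities are required only where the powers are regular, since they cannot hold at every point. *)

(* Defs.v *)
From Stdlib Require Import Reals List.
From Coquelicot Require Import Coquelicot.
Import ListNotations.

Open Scope C_scope.

(** * Non-uniform lattices *)

Definition cexp (z : C) : C :=
  RtoC (exp (Re z)) * (RtoC (cos (Im z)) + Ci * RtoC (sin (Im z))).

(* In [q_lattice q w c1 c2 c3] the number [w] is a logarithm of [q]; it fixes
   the branch q^s := cexp (w * s), including that of q^(eta/2). *)
Inductive lattice :=
| q_lattice (q w c1 c2 c3 : C)
| quadratic_lattice (c1 c2 c3 : C).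

Definition is_lattice (L : lattice) : Prop :=
  match L with
  | q_lattice q w c1 c2 _ =>
      q <> 0 /\ q <> 1 /\ cexp w = q /\ c1 * c2 <> 0
  | quadratic_lattice c1 c2 _ => c1 * c2 <> 0
  end.

Definition lat (L : lattice) (s : C) : C :=
  match L with
  | q_lattice _ w c1 c2 c3 => c1 * cexp (w * s) + c2 * cexp (- (w * s)) + c3
  | quadratic_lattice c1 c2 c3 => c1 * (s * s) + c2 * s + c3
  end.

(* x_eta *)
Definition xs (L : lattice) (eta : R) (s : C) : C := lat L (s + RtoC (eta / 2)).

Definition fdelta (f : C -> C) (s : C) : C := f (s + 1) - f s.
Definition nabla (f : C -> C) (s : C) : C := f s - f (s - 1).

Definition alpha (L : lattice) (eta : R) : C :=
  match L with
  | q_lattice _ w _ _ _ =>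
      (cexp (w * RtoC (eta / 2)) + cexp (- (w * RtoC (eta / 2)))) / 2
  | quadratic_lattice _ _ _ => 1
  end.

Definition gamma (L : lattice) (eta : R) : C :=
  match L with
  | q_lattice _ w _ _ _ =>
      (cexp (w * RtoC (eta / 2)) - cexp (- (w * RtoC (eta / 2)))) /
      (cexp (w * RtoC (1 / 2)) - cexp (- (w * RtoC (1 / 2))))
  | quadratic_lattice _ _ _ => RtoC eta
  end.

(** * Coefficients of the equation *)

(* sigma~[x] = sg2 x^2 + sg1 x + sg0 and tau~[x] = tu1 x + tu0. *)
Record coeffs := Coeffs { sg2 : C; sg1 : C; sg0 : C; tu1 : C; tu0 : C }.

Section Equation.

Variables (L : lattice) (P : coeffs).

Definition tau_z (z : C) : C := tu1 P * lat L z + tu0 P.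

Definition sigma_z (z : C) : C :=
  (sg2 P * (lat L z * lat L z) + sg1 P * lat L z + sg0 P)
  - / 2 * tau_z z * nabla (xs L 1) z.

(* Meaningful where nabla x_(eta+1) does not vanish. *)
Definition tau_eta (eta : R) (z : C) : C :=
  (sigma_z (z + RtoC eta) - sigma_z z
   + tau_z (z + RtoC eta) * nabla (xs L 1) (z + RtoC eta))
  / nabla (xs L (eta + 1)) z.

(* On a quadratic lattice this is tau~' + (eta - 1)/2 sigma~''. On a q-lattice
   that expression has to be read with alpha(eta - 1) in front of tau~' and
   with gamma(eta - 1) for eta - 1: this is what makes kappa_(2 eta + 1) the
   leading coefficient of tau_eta as a polynomial in x_eta and lambda - kappa_(-1)
   the constant term of the adjoint equation. *)
Definition kappa (eta : R) : C :=
  alpha L (eta - 1) * tu1 P + / 2 * gamma L (eta - 1) * (2 * sg2 P).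

Definition adjoint_lhs (lams : C) (y : C -> C) (z : C) : C :=
  sigma_z (z + 1)
    * (fdelta (fun t => nabla y t / nabla (lat L) t) z / fdelta (xs L (-1)) z)
  - tau_eta (-2) (z + 1) * (nabla y z / nabla (lat L) z)
  + lams * y z.

(* [Z] is the set on which [y] is considered; the equation at [z] involves
   y (z - 1), y z and y (z + 1). *)
Definition solves_adjoint (lams : C) (Z : C -> Prop) (y : C -> C) : Prop :=
  forall z, Z (z - 1) -> Z z -> Z (z + 1) ->
    nabla (lat L) z <> 0 -> nabla (lat L) (z + 1) <> 0 ->
    fdelta (xs L (-1)) z <> 0 ->
    adjoint_lhs lams y z = 0.

(* Delta [sigma r] / nabla x_(eta+1) = t r, at the points of [D]. *)
Definition pearson (eta : R) (t : C -> C) (D : C -> Prop) (r : C -> C) : Prop :=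
  forall z, D z -> nabla (xs L (eta + 1)) z <> 0 ->
    fdelta (fun u => sigma_z u * r u) z / nabla (xs L (eta + 1)) z = t z * r z.

End Equation.

(** * Generalized powers *)

(* [gp eta m s z] is [x_eta(s) - x_eta(z)]^(m). For a general real [m] it is a
   meromorphic function of (s, z), and its defining identities cannot hold at
   all points: for m = -1 and s = z the first one would read 0 = 1. So a
   generalized power comes with its domain of regularity [gp_dom]; wherever the
   power of order [m] is regular, so is the product that defines the power of
   order [m + 1]. *)
Record gen_power (L : lattice) := GenPower {
  gp : R -> R -> C -> C -> C;
  gp_dom : R -> R -> C -> C -> Prop;
  gp_zero : forall eta s z, gp_dom eta 0 s z /\ gp eta 0 s z = 1;
  gp_rec1 : forall eta m s z, gp_dom eta m s (z - 1) ->
    gp_dom eta (m + 1) s z /\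
    (xs L eta s - xs L eta z) * gp eta m s (z - 1) = gp eta (m + 1) s z;
  gp_rec2 : forall eta m s z, gp_dom eta m s z ->
    gp_dom eta (m + 1) s z /\
    gp eta m s z * (xs L eta s - xs L eta (z - RtoC m)) = gp eta (m + 1) s z;
  gp_rec3 : forall eta m s z, gp_dom (eta - 1) m (s + 1) z ->
    gp_dom eta (m + 1) s z /\
    gp (eta - 1) m (s + 1) z * (xs L (eta - m) s - xs L (eta - m) z)
      = gp eta (m + 1) s z;
  gp_rec4 : forall eta m s z, gp_dom (eta - 1) m s z ->
    gp_dom eta (m + 1) s z /\
    (xs L (eta - m) (s + RtoC m) - xs L (eta - m) z) * gp (eta - 1) m s z
      = gp eta (m + 1) s z }.

Arguments gp {L} g eta m s z.
Arguments gp_dom {L} g eta m s z.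
Arguments gp_zero {L} g eta s z.
Arguments gp_rec1 {L} g eta m s z.
Arguments gp_rec2 {L} g eta m s z.
Arguments gp_rec3 {L} g eta m s z.
Arguments gp_rec4 {L} g eta m s z.

Definition gp_ok {L} (G : gen_power L) (eta m : R) (s z : C) : Prop :=
  gp_dom G eta m s z /\ gp G eta m s z <> 0.

Fixpoint gp_prod (L : lattice) (eta : R) (m : nat) (s z : C) : C :=
  match m with
  | O => 1
  | S k => gp_prod L eta k s z * (xs L eta s - xs L eta (z - RtoC (INR k)))
  end.

Lemma gp_nat L (G : gen_power L) eta (m : nat) s z :
  gp_dom G eta (INR m) s z /\ gp G eta (INR m) s z = gp_prod L eta m s z.
Proof.
induction m as [|m [IHd IH]].
- exact (gp_zero G eta s z).
- rewrite S_INR; destruct (gp_rec2 G eta (INR m) s z IHd) as [Hd H].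
  split; [exact Hd|]. simpl. now rewrite <- IH, <- H.
Qed.

(** * Sums and contour integrals *)

(* The sum over s = a, a + 1, ..., a + N - 1. *)
Fixpoint grid_sum (f : C -> C) (a : C) (N : nat) : C :=
  match N with
  | O => 0
  | S n => grid_sum f a n + f (a + RtoC (INR n))
  end.

Definition on_grid (a : C) (N : nat) (s : C) : Prop :=
  exists n : nat, (n < N)%nat /\ s = a + RtoC (INR n).

(* A contour is a piecewise C^1 curve: a list of C^1 arcs parametrized by [0, 1],
   each starting where the previous one ends. A C^1 function on [0, 1] extends
   to a C^1 function on R, so two-sided derivatives at 0 and 1 lose nothing.
   Contours need not be closed. *)
Record arc := Arc { arc_pt : R -> C; arc_vel : R -> C }.

Definition C1_arc (g : arc) : Prop :=
  forall t : R, (0 <= t <= 1)%R ->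
    is_derive (K := R_AbsRing) (V := C_R_NormedModule) (arc_pt g) t (arc_vel g t)
    /\ continuous (U := C_R_NormedModule) (arc_vel g) t.

Fixpoint joined (c : list arc) : Prop :=
  match c with
  | g :: ((h :: _) as c') => arc_pt g 1%R = arc_pt h 0%R /\ joined c'
  | _ => True
  end.

Definition is_contour (c : list arc) : Prop :=
  c <> [] /\ List.Forall C1_arc c /\ joined c.

Definition on_contour (c : list arc) (s : C) : Prop :=
  exists (g : arc) (t : R), List.In g c /\ (0 <= t <= 1)%R /\ s = arc_pt g t.

Definition arc_integrand (f : C -> C) (g : arc) (t : R) : C :=
  f (arc_pt g t) * arc_vel g t.

Definition ex_contour_int (c : list arc) (f : C -> C) : Prop :=
  List.Forall (fun g => ex_RInt (V := C_R_NormedModule) (arc_integrand f g) 0 1) c.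

Definition contour_int (c : list arc) (f : C -> C) : C :=
  fold_right
    (fun g v => RInt (V := C_R_CompleteNormedModule) (arc_integrand f g) 0 1 + v)
    (RtoC 0) c.

(** * The functions phi_(nu,m) and psi_(nu,nu) *)

Section Solutions.

Variables (L : lattice) (P : coeffs) (G : gen_power L) (nu : R) (rho_nu : C -> C).

Definition kernel (m : R) (z s : C) : C :=
  rho_nu s * nabla (xs L (nu + 1)) s / gp G nu (m + 1) s z.

Definition phi_sum (a : C) (N : nat) (m : R) (z : C) : C :=
  grid_sum (kernel m z) a N.

Definition phi_oint (c : list arc) (m : R) (z : C) : C :=
  contour_int c (kernel m z).

Definition psi_nn (s z : C) : C :=
  sigma_z L P s * rho_nu s / gp G (nu - 1) (nu + 1) s (z + 1).

(* The denominators of kernel nu, kernel (nu + 1), psi_nn and Delta_s psi_nn (and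
   that of the equation for rho_nu) do not vanish for s in [S] and z in [Z]. *)
Definition denominators_ok (S Z : C -> Prop) : Prop :=
  forall s, S s ->
    nabla (xs L (nu + 1)) s <> 0 /\
    forall z, Z z ->
      gp_ok G nu (nu + 1) s z /\
      gp_ok G nu (nu + 1 + 1) s z /\
      gp_ok G (nu - 1) (nu + 1) s (z + 1) /\
      gp_ok G (nu - 1) (nu + 1) (s + 1) (z + 1).

(* nabla phi_(nu,nu) / nabla x = gamma(nu + 1) phi_(nu,nu+1) *)
Definition difference_formula (Z : C -> Prop) (phi : R -> C -> C) : Prop :=
  forall z, Z (z - 1) -> Z z -> nabla (lat L) z <> 0 ->
    nabla (phi nu) z / nabla (lat L) z = gamma L (nu + 1) * phi (nu + 1)%R z.

End Solutions.

(* Main.v *)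
Require Import Defs.
From Stdlib Require Import Reals List Lra Lia.
From Coquelicot Require Import Coquelicot.

(** Write theta for sigma + tau nabla x_1, that is sigma~ + tau~ nabla x_1 / 2,
    gamma for gamma(nu + 1) and phi_m for phi_(nu,m). With y = phi_nu the
    difference formula replaces nabla y / nabla x by gamma phi_(nu+1), and the
    numerator of tau_(-2)(z + 1) is theta(z - 1) - sigma(z + 1). After
    multiplication by Delta x_(-1)(z) and use of the condition on nu, the adjoint
    equation is therefore the three-term relation
    gamma [sigma(z+1) phi_(nu+1)(z+1) - theta(z-1) phi_(nu+1)(z)
           - kappa_(nu-1) Delta x_(-1)(z) phi_nu(z)] = 0
    ([adjoint_of_three_term]).

    This relation holds because the same combination of the kernels is an exact
    difference in s, namely Delta_s [psi(s, z-1) - psi(s, z)]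
    ([kernel_telescopes]); summation or integration then leaves only the boundary
    terms, which vanish by hypothesis at z and at z - 1. A single psi(s, z) cannot
    serve: its denominator is a power of order nu + 1, while the three kernels
    together have a denominator of order nu + 3. Taking the difference in z
    supplies the missing order, as differentiating 1/(s - z)^(nu+1) in z does in
    the continuous case.

    The exactness is checked pointwise. The equation for rho_nu gives
    sigma(s+1) rho_nu(s+1) = theta(s+nu) rho_nu(s), and the recurrences of the
    generalized powers express every power that occurs through
    [x_nu(s) - x_nu(z)]^(nu+1) and differences of lattice values. What is left is
    the identity [kernel_identity], polynomial in nu, s, z on a quadratic lattice
    and rational in q^s, q^z, q^(nu/2), q^(1/2) on a q-lattice. *)

Open Scope C_scope.

(** * The exponential *)

Lemma cexp_plus (u v : C) : cexp (u + v) = cexp u * cexp v.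
Proof.
destruct u as [a b], v as [c d].
unfold cexp, Re, Im; simpl; rewrite exp_plus, cos_plus, sin_plus.
apply injective_projections; simpl; ring.
Qed.

Lemma cexp_0 : cexp 0 = 1.
Proof.
unfold cexp; simpl; rewrite exp_0, cos_0, sin_0.
apply injective_projections; simpl; ring.
Qed.

Lemma cexp_plus_opp (u : C) : cexp u * cexp (- u) = 1.
Proof. now rewrite <- cexp_plus, Cplus_opp_r, cexp_0. Qed.

Lemma cexp_neq_0 (u : C) : cexp u <> 0.
Proof.
intros H; apply C1_nz.
now rewrite <- (cexp_plus_opp u), H, Cmult_0_l.
Qed.

Lemma cexp_opp (u : C) : cexp (- u) = / cexp u.
Proof.
rewrite <- (Cmult_1_l (/ cexp u)), <- (cexp_plus_opp u).
field; apply cexp_neq_0.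
Qed.

(** * The algebraic identity behind the equation *)

(** The mirror image sigma~ + tau~ nabla x_1 / 2 of sigma; for every eta the
    numerator of tau_eta(z) is theta(z + eta) - sigma(z). *)
Definition theta_z (L : lattice) (P : coeffs) (z : C) : C :=
  sigma_z L P z + tau_z L P z * nabla (xs L 1) z.

(** Up to the factor rho_nu(s) and the common denominator
    [x_nu(s) - x_nu(z)]^(nu+1) u v, the left side is the combination of the three
    kernels, and the right side is the difference in z of Delta_s psi. The factor
    gamma(nu + 1) is kept so that the case where it vanishes is included. *)
Definition kernel_identity (L : lattice) (P : coeffs) (nu : R) (s z : C) : Prop :=
  let u := xs L nu s - xs L nu (z + 1) in
  let v := xs L nu s - xs L nu (z - RtoC (nu + 1)) in
  let A (t : C) := xs L (-1) (s + RtoC (nu + 1)) - xs L (-1) t in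
  let B (t : C) := xs L (-1) s - xs L (-1) t in
  gamma L (nu + 1) * nabla (xs L (nu + 1)) s
    * (sigma_z L P (z + 1) * v - theta_z L P (z - 1) * u
       - kappa L P (nu - 1) * fdelta (xs L (-1)) z * (u * v))
  = (theta_z L P (s + RtoC nu) * B z - sigma_z L P s * A z) * u
    - (theta_z L P (s + RtoC nu) * B (z + 1) - sigma_z L P s * A (z + 1)) * v.

Lemma kernel_identity_quadratic (c1 c2 c3 : C) (P : coeffs) (nu : R) (s z : C) :
  kernel_identity (quadratic_lattice c1 c2 c3) P nu s z.
Proof.
destruct P as [g2 g1 g0 t1 t0].
unfold kernel_identity, theta_z, sigma_z, tau_z, kappa, xs, fdelta, nabla, lat,
  gamma, alpha; cbn [sg2 sg1 sg0 tu1 tu0].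
unfold Rdiv, Rminus.
rewrite ?RtoC_mult, ?RtoC_plus, ?RtoC_opp, ?RtoC_inv by lra.
field.
Qed.

(** Every shift of s and z is a multiple of nu/2 plus a multiple of 1/2, so each
    lattice value is c1 m + c2 / m + c3 with m a monomial in q^s, q^z, n = q^(nu/2)
    and h = q^(1/2). These are treated as independent variables; h^2 <> 1 makes the
    denominator h - 1/h of gamma nonzero. *)
Lemma kernel_identity_q (q w c1 c2 c3 : C) (P : coeffs) (nu : R) (s z : C) :
  q <> 1 -> cexp w = q -> kernel_identity (q_lattice q w c1 c2 c3) P nu s z.
Proof.
intros Hq Hw.
destruct P as [g2 g1 g0 t1 t0].
unfold kernel_identity, theta_z, sigma_z, tau_z, kappa, xs, fdelta, nabla, lat,
  gamma, alpha; cbn [sg2 sg1 sg0 tu1 tu0].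
set (n := cexp (w * RtoC (nu / 2))).
set (h := cexp (w * RtoC (1 / 2))).
assert (H1 : cexp (w * 1) = h * h).
{ unfold h; rewrite <- cexp_plus; f_equal; rewrite RtoC_div by lra; field. }
assert (Hm : cexp (w * RtoC (-1 / 2)) = / h).
{ unfold h; rewrite <- cexp_opp; f_equal.
  replace (-1 / 2)%R with (- (1 / 2))%R by field.
  rewrite RtoC_opp; ring. }
assert (Hn : cexp (w * RtoC nu) = n * n).
{ unfold n; rewrite <- cexp_plus; f_equal; rewrite RtoC_div by lra; field. }
assert (Hnh : cexp (w * RtoC ((nu + 1) / 2)) = n * h).
{ unfold n, h; rewrite <- cexp_plus; f_equal.
  rewrite !RtoC_div, RtoC_plus by lra; field. }
assert (Hn1 : cexp (w * RtoC (nu + 1)) = n * n * (h * h)).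
{ now rewrite RtoC_plus, Cmult_plus_distr_l, cexp_plus, Hn, H1. }
assert (Hk : cexp (w * RtoC ((nu - 1 - 1) / 2)) = n / (h * h)).
{ rewrite <- H1; unfold Cdiv, n; rewrite <- cexp_opp, <- cexp_plus; f_equal.
  rewrite !RtoC_div, !RtoC_minus by lra; field. }
assert (Hhh : h * h <> 1) by now rewrite <- H1, Cmult_1_r, Hw.
assert (Hopp : forall t, w * - t = - (w * t)) by (intros; ring).
unfold Cminus.
repeat rewrite ?(Cmult_plus_distr_l w), ?Hopp, ?cexp_opp, ?cexp_plus.
fold h n; rewrite ?H1, ?Hm, ?Hn, ?Hnh, ?Hn1, ?Hk.
assert (Hs := cexp_neq_0 (w * s)); assert (Hz := cexp_neq_0 (w * z)).
assert (Hn0 : n <> 0) by apply cexp_neq_0.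
assert (Hh0 : h <> 0) by apply cexp_neq_0.
clearbody n h; clear H1 Hm Hn Hnh Hn1 Hk.
revert Hs Hz; generalize (cexp (w * s)) (cexp (w * z)); intros S Z HS HZ.
field.
repeat split; auto.
intros H; apply Hhh.
replace (h * h) with (h * h + -1 + 1) by ring.
rewrite H; ring.
Qed.

Lemma kernel_identity_lattice (L : lattice) (P : coeffs) (nu : R) (s z : C) :
  is_lattice L -> kernel_identity L P nu s z.
Proof.
destruct L as [q w c1 c2 c3|c1 c2 c3].
- intros (_ & Hq & Hw & _); now apply kernel_identity_q.
- intros _; apply kernel_identity_quadratic.
Qed.

(** * Consequences of the equation for rho_nu *)

Lemma tau_eta_nabla (L : lattice) (P : coeffs) (eta : R) (z : C) :
  nabla (xs L (eta + 1)) z <> 0 ->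
  sigma_z L P z + tau_eta L P eta z * nabla (xs L (eta + 1)) z
  = theta_z L P (z + RtoC eta).
Proof. intros H; unfold tau_eta, theta_z; field; exact H. Qed.

(** The equation for rho_nu is a first-order recurrence for sigma rho_nu, because
    adding sigma(s) cancels the term - sigma(s) in the numerator of tau_nu(s). *)
Lemma pearson_step (L : lattice) (P : coeffs) (nu : R) (D : C -> Prop)
    (r : C -> C) (s : C) :
  pearson L P nu (tau_eta L P nu) D r -> D s ->
  nabla (xs L (nu + 1)) s <> 0 ->
  sigma_z L P (s + 1) * r (s + 1) = theta_z L P (s + RtoC nu) * r s.
Proof.
intros Hr Ds Hs; rewrite <- tau_eta_nabla by exact Hs.
assert (E := Hr s Ds Hs); unfold fdelta in E.
transitivity (sigma_z L P s * r s
  + (sigma_z L P (s + 1) * r (s + 1) - sigma_z L P s * r s)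
    / nabla (xs L (nu + 1)) s * nabla (xs L (nu + 1)) s).
- field; exact Hs.
- rewrite E; ring.
Qed.

(** * The kernels combine to an exact difference *)

Lemma Cmult_neq_0_inv (a b : C) : a * b <> 0 -> a <> 0 /\ b <> 0.
Proof.
intros H; split; intros E; apply H; rewrite E; ring.
Qed.

(** The powers in psi(s, z - 1) and psi(s + 1, z - 1) both divide the one in the
    kernel of order nu + 1, with lattice differences as quotients. *)
Lemma gp_shift (L : lattice) (G : gen_power L) (nu : R) (s z : C) :
  gp_dom G (nu - 1) (nu + 1) s z -> gp_dom G (nu - 1) (nu + 1) (s + 1) z ->
  (xs L (-1) (s + RtoC (nu + 1)) - xs L (-1) z) * gp G (nu - 1) (nu + 1) s z
    = gp G nu (nu + 1 + 1) s z /\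
  (xs L (-1) s - xs L (-1) z) * gp G (nu - 1) (nu + 1) (s + 1) z
    = gp G nu (nu + 1 + 1) s z.
Proof.
intros H H'.
replace (-1)%R with (nu - (nu + 1))%R by ring; split.
- exact (proj2 (gp_rec4 G nu (nu + 1) s z H)).
- rewrite Cmult_comm; exact (proj2 (gp_rec3 G nu (nu + 1) s z H')).
Qed.

(** The shift from z to z - 1 turns the argument z + 1 in psi into z, so that
    Delta_s psi has the denominator of the kernel of order nu + 1 at z. *)
Lemma fdelta_psi (L : lattice) (P : coeffs) (G : gen_power L) (nu : R)
    (D : C -> Prop) (r : C -> C) (s z : C) :
  pearson L P nu (tau_eta L P nu) D r -> D s -> nabla (xs L (nu + 1)) s <> 0 ->
  gp_ok G (nu - 1) (nu + 1) s z -> gp_ok G (nu - 1) (nu + 1) (s + 1) z ->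
  gp G nu (nu + 1 + 1) s z <> 0 ->
  fdelta (fun t => psi_nn L P G nu r t (z - 1)) s
  = r s
    * (theta_z L P (s + RtoC nu) * (xs L (-1) s - xs L (-1) z)
       - sigma_z L P s * (xs L (-1) (s + RtoC (nu + 1)) - xs L (-1) z))
    / gp G nu (nu + 1 + 1) s z.
Proof.
intros Hr Ds Hs [HdA HA] [HdB HB] HQ.
destruct (gp_shift L G nu s z HdA HdB) as [EA EB].
unfold fdelta, psi_nn.
replace (z - 1 + 1) with z by ring.
rewrite (pearson_step L P nu D r s Hr Ds Hs).
assert (EA' := HQ); rewrite <- EA in EA'.
assert (EB' := HQ); rewrite <- EB in EB'.
apply Cmult_neq_0_inv in EA'; apply Cmult_neq_0_inv in EB'.
replace (gp G (nu - 1) (nu + 1) s z) with (gp G nu (nu + 1 + 1) s z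
  / (xs L (-1) (s + RtoC (nu + 1)) - xs L (-1) z))
  by (rewrite <- EA; field; apply EA').
replace (gp G (nu - 1) (nu + 1) (s + 1) z) with (gp G nu (nu + 1 + 1) s z
  / (xs L (-1) s - xs L (-1) z))
  by (rewrite <- EB; field; apply EB').
field.
repeat split; solve [exact HQ | apply EA' | apply EB'].
Qed.

(** The equation under the summation or integration sign. The powers of order
    nu + 2 at z and z + 1 are v and u times the power of order nu + 1 at z, which
    reduces the claim to [kernel_identity]; that u and v do not vanish follows
    from the powers of order nu + 2 being nonzero. *)
Lemma kernel_telescopes (L : lattice) (P : coeffs) (G : gen_power L) (nu : R)
    (D S Z : C -> Prop) (r : C -> C) (s z : C) :
  is_lattice L -> pearson L P nu (tau_eta L P nu) D r ->
  denominators_ok L G nu S Z -> S s -> D s ->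
  Z (z - 1) -> Z z -> Z (z + 1) ->
  gamma L (nu + 1) * sigma_z L P (z + 1) * kernel L G nu r (nu + 1) (z + 1) s
  + - (gamma L (nu + 1) * theta_z L P (z - 1)) * kernel L G nu r (nu + 1) z s
  + - (gamma L (nu + 1) * kappa L P (nu - 1) * fdelta (xs L (-1)) z)
    * kernel L G nu r nu z s
  = fdelta (fun t => psi_nn L P G nu r t (z - 1)) s
    - fdelta (fun t => psi_nn L P G nu r t z) s.
Proof.
intros HL Hr Hden Ss Ds Z0 Z1 Z2.
destruct (Hden s Ss) as [Hs Hpow].
destruct (Hpow (z - 1) Z0) as (_ & _ & A0 & B0).
destruct (Hpow z Z1) as ([HdP HP] & [_ HQ0] & A1 & B1).
destruct (Hpow (z + 1) Z2) as (_ & [_ HQ1] & _ & _).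
replace (z - 1 + 1) with z in A0, B0 by ring.
rewrite (fdelta_psi L P G nu D r s z Hr Ds Hs A0 B0 HQ0).
assert (E := fdelta_psi L P G nu D r s (z + 1) Hr Ds Hs A1 B1 HQ1).
replace (z + 1 - 1) with z in E by ring.
rewrite E; clear E.
assert (EQ0 := proj2 (gp_rec2 G nu (nu + 1) s z HdP)).
assert (HdP' : gp_dom G nu (nu + 1) s (z + 1 - 1))
  by (replace (z + 1 - 1) with z by ring; exact HdP).
assert (EQ1 := proj2 (gp_rec1 G nu (nu + 1) s (z + 1) HdP')).
replace (z + 1 - 1) with z in EQ1 by ring.
rewrite <- EQ0 in HQ0; rewrite <- EQ1 in HQ1.
unfold kernel; rewrite <- EQ0, <- EQ1.
assert (K := kernel_identity_lattice L P nu s z HL).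
unfold kernel_identity in K; cbv zeta beta in K.
apply Cmult_neq_0_inv in HQ0; apply Cmult_neq_0_inv in HQ1.
destruct HQ0 as [_ Hv], HQ1 as [Hu _].
revert K Hu Hv.
generalize (xs L nu s - xs L nu (z + 1)) (xs L nu s - xs L nu (z - RtoC (nu + 1))).
intros u v K Hu Hv.
match type of K with ?lhs = _ =>
  transitivity (r s / (gp G nu (nu + 1) s z * (u * v)) * lhs)
end.
- field; repeat split; assumption.
- rewrite K; field; repeat split; assumption.
Qed.

(** * From the three-term relation to the adjoint equation *)

(** The terms of the equation in sigma(z + 1) phi_(nu+1)(z) cancel, since
    tau_(-2)(z + 1) Delta x_(-1)(z) = theta(z - 1) - sigma(z + 1). *)
Lemma adjoint_of_three_term (L : lattice) (P : coeffs) (nu : R) (lams : C)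
    (Z : C -> Prop) (phi : R -> C -> C) :
  lams + kappa L P (nu - 1) * gamma L (nu + 1) = 0 ->
  difference_formula L nu Z phi ->
  (forall z, Z (z - 1) -> Z z -> Z (z + 1) ->
     gamma L (nu + 1) * sigma_z L P (z + 1) * phi (nu + 1)%R (z + 1)
     + - (gamma L (nu + 1) * theta_z L P (z - 1)) * phi (nu + 1)%R z
     + - (gamma L (nu + 1) * kappa L P (nu - 1) * fdelta (xs L (-1)) z) * phi nu z
     = 0) ->
  solves_adjoint L P lams Z (phi nu).
Proof.
intros Hnu Hphi H3 z Z0 Z1 Z2 Hx Hx1 Hd.
assert (E0 := Hphi z Z0 Z1 Hx).
(* The difference in z brings in the difference formula at z + 1 as well. *)
assert (E1 : nabla (phi nu) (z + 1) / nabla (lat L) (z + 1)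
             = gamma L (nu + 1) * phi (nu + 1)%R (z + 1)).
{ apply Hphi; [replace (z + 1 - 1) with z by ring|..]; assumption. }
(* tau_(-2)(z + 1) has the denominator nabla x_(-1)(z + 1) = Delta x_(-1)(z). *)
assert (Hdx : nabla (xs L (-2 + 1)) (z + 1) = fdelta (xs L (-1)) z).
{ unfold nabla, fdelta; replace (-2 + 1)%R with (-1)%R by ring.
  now replace (z + 1 - 1) with z by ring. }
assert (Ht := tau_eta_nabla L P (-2) (z + 1)); rewrite Hdx in Ht.
specialize (Ht Hd).
replace (z + 1 + RtoC (-2)) with (z - 1) in Ht by ring.
specialize (H3 z Z0 Z1 Z2).
unfold adjoint_lhs; unfold fdelta at 1.
rewrite E0, E1.
replace lams with (- (kappa L P (nu - 1) * gamma L (nu + 1)))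
  by (rewrite <- (Cplus_0_l (- _)), <- Hnu; ring).
rewrite <- Ht in H3.
match type of H3 with ?l = _ => transitivity (l / fdelta (xs L (-1)) z) end.
- field; exact Hd.
- rewrite H3; field; exact Hd.
Qed.

(** * Sums and contour integrals of combinations *)

Lemma grid_sum_combination (f1 f2 f3 g1 g2 : C -> C) (k1 k2 k3 a : C) (N : nat) :
  (forall s, on_grid a N s -> k1 * f1 s + k2 * f2 s + k3 * f3 s = g1 s - g2 s) ->
  k1 * grid_sum f1 a N + k2 * grid_sum f2 a N + k3 * grid_sum f3 a N
  = grid_sum g1 a N - grid_sum g2 a N.
Proof.
induction N as [|N IH]; intros H; simpl.
- ring.
- assert (E := H (a + RtoC (INR N)) (ex_intro _ N (conj (Nat.lt_succ_diag_r N) eq_refl))).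
  assert (E' : k1 * grid_sum f1 a N + k2 * grid_sum f2 a N + k3 * grid_sum f3 a N
    = grid_sum g1 a N - grid_sum g2 a N).
  { apply IH; intros s (n & Hn & ->); apply H; exists n; split; [lia|reflexivity]. }
  transitivity (grid_sum g1 a N - grid_sum g2 a N
    + (g1 (a + RtoC (INR N)) - g2 (a + RtoC (INR N)))).
  + rewrite <- E, <- E'; ring.
  + ring.
Qed.

Lemma grid_sum_fdelta (f : C -> C) (a : C) (N : nat) :
  grid_sum (fdelta f) a N = f (a + RtoC (INR N)) - f a.
Proof.
induction N as [|N IH].
- simpl; rewrite Cplus_0_r; ring.
- cbn [grid_sum]; rewrite IH, S_INR, RtoC_plus, Cplus_assoc.
  unfold fdelta; ring.
Qed.

(** The integral is that of a function with values in a real vector space, so a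
    complex factor has to be pulled out componentwise. *)
Lemma is_RInt_Cmult (k : C) (f : R -> C) (a b : R) (v : C) :
  is_RInt (V := C_R_NormedModule) f a b v ->
  is_RInt (V := C_R_NormedModule) (fun t => k * f t) a b (k * v).
Proof.
intros H.
assert (H1 := is_RInt_fct_extend_fst (U := R_NormedModule) (V := R_NormedModule)
  f a b v H).
assert (H2 := is_RInt_fct_extend_snd (U := R_NormedModule) (V := R_NormedModule)
  f a b v H).
destruct k as [k1 k2].
apply (is_RInt_fct_extend_pair (U := R_NormedModule) (V := R_NormedModule)).
- apply (is_RInt_minus (V := R_NormedModule));
    now apply (is_RInt_scal (V := R_NormedModule)).
- apply (is_RInt_plus (V := R_NormedModule));
    now apply (is_RInt_scal (V := R_NormedModule)).
Qed.

Lemma RInt_combination (f1 f2 f3 g1 g2 : R -> C) (k1 k2 k3 : C) (a b : R)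
    (I := fun f => RInt (V := C_R_CompleteNormedModule) f a b) :
  ex_RInt (V := C_R_NormedModule) f1 a b -> ex_RInt (V := C_R_NormedModule) f2 a b ->
  ex_RInt (V := C_R_NormedModule) f3 a b ->
  ex_RInt (V := C_R_NormedModule) g1 a b -> ex_RInt (V := C_R_NormedModule) g2 a b ->
  (forall t, (Rmin a b < t < Rmax a b)%R ->
     k1 * f1 t + k2 * f2 t + k3 * f3 t = g1 t - g2 t) ->
  k1 * I f1 + k2 * I f2 + k3 * I f3 = I g1 - I g2.
Proof.
intros F1 F2 F3 G1 G2 H.
assert (Hf : is_RInt (V := C_R_NormedModule)
  (fun t => k1 * f1 t + k2 * f2 t + k3 * f3 t) a b
  (k1 * I f1 + k2 * I f2 + k3 * I f3)).
{ apply (is_RInt_plus (V := C_R_NormedModule));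
    [apply (is_RInt_plus (V := C_R_NormedModule))|];
    apply is_RInt_Cmult; now apply (RInt_correct (V := C_R_CompleteNormedModule)). }
assert (Hg : is_RInt (V := C_R_NormedModule) (fun t => g1 t - g2 t) a b (I g1 - I g2)).
{ apply (is_RInt_minus (V := C_R_NormedModule));
    now apply (RInt_correct (V := C_R_CompleteNormedModule)). }
apply (is_RInt_unique (V := C_R_CompleteNormedModule)) in Hg.
rewrite <- Hg; symmetry.
apply (is_RInt_unique (V := C_R_CompleteNormedModule)).
exact (is_RInt_ext (V := C_R_NormedModule) _ _ _ _ _ H Hf).
Qed.

Lemma contour_int_combination (c : list arc) (f1 f2 f3 g1 g2 : C -> C) (k1 k2 k3 : C) :
  ex_contour_int c f1 -> ex_contour_int c f2 -> ex_contour_int c f3 ->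
  ex_contour_int c g1 -> ex_contour_int c g2 ->
  (forall s, on_contour c s -> k1 * f1 s + k2 * f2 s + k3 * f3 s = g1 s - g2 s) ->
  k1 * contour_int c f1 + k2 * contour_int c f2 + k3 * contour_int c f3
  = contour_int c g1 - contour_int c g2.
Proof.
induction c as [|g c IH]; intros F1 F2 F3 G1 G2 H; simpl.
- ring.
- inversion_clear F1; inversion_clear F2; inversion_clear F3.
  inversion_clear G1; inversion_clear G2.
  assert (E' : k1 * contour_int c f1 + k2 * contour_int c f2 + k3 * contour_int c f3
    = contour_int c g1 - contour_int c g2).
  { apply IH; try assumption.
    intros s (h & t & Hh & Ht); apply H; exists h, t; split; [now right|exact Ht]. }
  assert (E : k1 * RInt (V := C_R_CompleteNormedModule) (arc_integrand f1 g) 0 1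
    + k2 * RInt (V := C_R_CompleteNormedModule) (arc_integrand f2 g) 0 1
    + k3 * RInt (V := C_R_CompleteNormedModule) (arc_integrand f3 g) 0 1
    = RInt (V := C_R_CompleteNormedModule) (arc_integrand g1 g) 0 1
      - RInt (V := C_R_CompleteNormedModule) (arc_integrand g2 g) 0 1).
  { apply RInt_combination; try assumption.
    intros t Ht; rewrite Rmin_left, Rmax_right in Ht by lra; unfold arc_integrand.
    transitivity ((g1 (arc_pt g t) - g2 (arc_pt g t)) * arc_vel g t).
    - rewrite <- (H (arc_pt g t)); [ring|].
      exists g, t; repeat split; [now left|lra|lra].
    - ring. }
  transitivity (RInt (V := C_R_CompleteNormedModule) (arc_integrand g1 g) 0 1
      - RInt (V := C_R_CompleteNormedModule) (arc_integrand g2 g) 0 1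
      + (contour_int c g1 - contour_int c g2)).
  + rewrite <- E, <- E'; ring.
  + ring.
Qed.

(** * The solutions *)

Theorem theorem4p2
  (L : lattice) (HL : is_lattice L) (P : coeffs) (G : gen_power L)
  (nu : R) (lam lams : C) (Hlams : lams = lam - kappa L P (-1))
  (rho rho_nu : C -> C) (D : C -> Prop)
  (Hrho : pearson L P 0 (tau_z L P) D rho)
  (Hrho_nu : pearson L P nu (tau_eta L P nu) D rho_nu)
  (Hnu : lams + kappa L P (nu - 1) * gamma L (nu + 1) = 0) :
  (forall (a b : C) (N : nat) (Z : C -> Prop),
     Im a = Im b -> b - a = RtoC (INR N) ->
     (forall s, on_grid a N s -> D s) ->
     denominators_ok L G nu (on_grid a N) Z ->
     difference_formula L nu Z (phi_sum L G nu rho_nu a N) ->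
     (forall z, Z z -> psi_nn L P G nu rho_nu a z = psi_nn L P G nu rho_nu b z) ->
     solves_adjoint L P lams Z (phi_sum L G nu rho_nu a N nu))
  /\
  (forall (c : list arc) (Z : C -> Prop),
     is_contour c ->
     (forall s, on_contour c s -> D s) ->
     denominators_ok L G nu (on_contour c) Z ->
     (forall z, Z z ->
        ex_contour_int c (kernel L G nu rho_nu nu z) /\
        ex_contour_int c (kernel L G nu rho_nu (nu + 1) z) /\
        ex_contour_int c (fdelta (fun s => psi_nn L P G nu rho_nu s z))) ->
     difference_formula L nu Z (phi_oint L G nu rho_nu c) ->
     (forall z, Z z ->
        contour_int c (fdelta (fun s => psi_nn L P G nu rho_nu s z)) = 0) ->
     solves_adjoint L P lams Z (phi_oint L G nu rho_nu c nu)).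
Proof.
clear Hlams Hrho; split.
- intros a b N Z _ Hab HD Hden Hdiff Hpsi.
  apply (adjoint_of_three_term L P nu lams Z (phi_sum L G nu rho_nu a N));
    [exact Hnu|exact Hdiff|].
  intros z Z0 Z1 Z2; unfold phi_sum.
  rewrite (grid_sum_combination _ _ _
    (fdelta (fun t => psi_nn L P G nu rho_nu t (z - 1)))
    (fdelta (fun t => psi_nn L P G nu rho_nu t z))).
  + rewrite !grid_sum_fdelta.
    replace (a + RtoC (INR N)) with b by (rewrite <- Hab; ring).
    rewrite (Hpsi z Z1), (Hpsi (z - 1) Z0); ring.
  + intros s Hs.
    exact (kernel_telescopes L P G nu D (on_grid a N) Z rho_nu s z
      HL Hrho_nu Hden Hs (HD s Hs) Z0 Z1 Z2).
- intros c Z _ HD Hden Hex Hdiff Hpsi.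
  apply (adjoint_of_three_term L P nu lams Z (phi_oint L G nu rho_nu c));
    [exact Hnu|exact Hdiff|].
  intros z Z0 Z1 Z2; unfold phi_oint.
  destruct (Hex (z - 1) Z0) as (_ & _ & G0).
  destruct (Hex z Z1) as (F & F0 & G1).
  destruct (Hex (z + 1) Z2) as (_ & F1 & _).
  rewrite (contour_int_combination c _ _ _
    (fdelta (fun t => psi_nn L P G nu rho_nu t (z - 1)))
    (fdelta (fun t => psi_nn L P G nu rho_nu t z))); try assumption.
  + rewrite (Hpsi z Z1), (Hpsi (z - 1) Z0); ring.
  + intros s Hs.
    exact (kernel_telescopes L P G nu D (on_contour c) Z rho_nu s z
      HL Hrho_nu Hden Hs (HD s Hs) Z0 Z1 Z2).
Qed.
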